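(* Let $G$ be a finite undirected graph (possibly with loops and multiple edges) with nonempty vertex set $V$ and edge set $E$, and let $b\in\mathbb{R}^V$ be nonzero with all entries nonnegative. Let $H$ be a spanning subgraph of $G$. If $H$ is bipartite, then the following are equivalent: (i) $H$ is a graph of $\mathcal{P}(G,b)$, i.e. $H\in\mathcal{G}(G,b)$; (ii) $H$ is the graph of a subset of $\mathcal{P}(G,b)$; (iii) $H$ is the graph of an element of $\mathcal{P}(G,b)$, or $H$ has no edges; (iv) $H$ is the graph of a face of $\mathcal{P}(G,b)$; (v) $H$ is a union of graphs of vertices of $\mathcal{P}(G,b)$; (vi) $H$ is the union of the graphs of all vertices of $\mathcal{P}(G,b)$ whose graph is contained in $H$; (vii) $H$ has no edges, or else: $\sum_{v\in V_1}b_v\ge\sum_{v\in V_3}b_v$ for all pairwise disjoint (possibly empty) sets $V_1,V_2,V_3$ such that $V=V_1\cup V_2\cup V_3$ and $H[V_2\cup V_3,V_3]=\emptyset$, with the inequality holding as an equality if and only if $H[V_1,V_1\cup V_2]=\emptyset$; (viii) $H$ has no edges, or else: $\sum_{v\in C}b_v\ge\sum_{v\in V\setminus C}b_v$ for each vertex cover $C$ of $H$, with the inequality holding as an equality if and only if $V\setminus C$ is also a vertex cover of $H$.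
   Context: $\delta_G(v)$ denotes the set of edges of $G$ incident with $v$; a loop at $v$ appears once in $\delta_G(v)$. $\mathcal{P}(G,b)=\{x\in\mathbb{R}^E \mid x_e\ge 0 \text{ for each } e\in E,\ \sum_{e\in\delta_G(v)}x_e=b_v \text{ for each } v\in V\}$ (a polytope; empty when $E=\emptyset$, since $b\ne0$). The faces of a polytope include $\emptyset$ and the polytope itself. A spanning subgraph of $G$ is a subgraph with vertex set $V$. For $X\subset\mathcal{P}(G,b)$, the graph $\mathrm{gr}(X)$ of $X$ is the spanning subgraph of $G$ with edge set $\{e\in E\mid \text{there exists } x\in X\text{ with }x_e>0\}$, and the graph of an element $x$ is $\mathrm{gr}(x)=\mathrm{gr}(\{x\})$. $\mathcal{G}(G,b)=\{\mathrm{gr}(X)\mid X\subset\mathcal{P}(G,b)\}$, whose elements are called the graphs of $\mathcal{P}(G,b)$. Union and containment of spanning subgraphs of $G$ mean union and containment of their edge sets; an empty union is the spanning subgraph with no edges. For $U,W\subset V$, $H[U,W]$ is the set of all edges of $H$ whose endpoints are $u$ and $w$ for some $u\in U$ and $w\in W$. A vertex cover of $H$ is a subset of $V$ which contains an endpoint of every edge of $H$. *)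

(* Defs.v *)
From HB Require Import structures.
From mathcomp Require Import all_boot all_order all_algebra.
From mathcomp Require Import boolp classical_sets reals.

Set Implicit Arguments.
Unset Strict Implicit.
Unset Printing Implicit Defensive.

Import Order.TTheory GRing.Theory Num.Theory.
Local Open Scope ring_scope.

(* [ends e] is the set of endpoints of [e]; a loop has a single endpoint.
   Distinct edges may have the same ends. *)
Record multigraph := Multigraph {
  vertex : finType;
  edge : finType;
  ends : edge -> {set vertex};
  ends_card : forall e, (0 < #|ends e| <= 2)%N
}.

(* Spanning subgraphs of [G] all have vertex set [vertex G], so they are
   represented by their edge sets, as elements of [{set edge G}]. *)
Section Graphs.
Context (G : multigraph).
Implicit Types (H : {set edge G}) (U W C : {set vertex G}).

Definition incident (v : vertex G) : {set edge G} :=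
  [set e | v \in ends e]%SET.

Definition edges_between H U W : {set edge G} :=
  [set e in H | [exists u in U, exists w in W, ends e == [set u; w]%SET]]%SET.

Definition bipartite H : Prop :=
  exists U W, [/\ [disjoint U & W], U :|: W = [set: vertex G]%SET
                & edges_between H U W = H].

Definition vertex_cover H C : Prop :=
  forall e, e \in H -> exists2 v, v \in C & v \in ends e.

End Graphs.

Section Faces.
Context (R : realType) (I : finType).
Local Open Scope classical_set_scope.

(* The choices [c = 0], [d = 1] and [c = 0], [d = 0] make [set0] and [P]
   itself faces of [P]. *)
Definition is_face (P F : set {ffun I -> R}) : Prop :=
  exists (c : {ffun I -> R}) (d : R),
    (forall x, P x -> \sum_i c i * x i <= d) /\
    F = [set x | P x /\ \sum_i c i * x i = d].

Definition is_vertex (P : set {ffun I -> R}) (x : {ffun I -> R}) : Prop :=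
  is_face P [set x].

End Faces.

Section Polytope.
Context (R : realType) (G : multigraph) (b : {ffun vertex G -> R}).

Definition polytope : set {ffun edge G -> R} :=
  [set x | (forall e, 0 <= x e) /\
           (forall v, \sum_(e in incident v) x e = b v)]%classic.

Definition gr (X : set {ffun edge G -> R}) : {set edge G} :=
  [set e | `[< exists2 x, X x & 0 < x e >]]%SET.

Definition graphs : set {set edge G} :=
  [set gr X | X in [set X | X `<=` polytope]]%classic.

Definition vertex_graphs : {set {set edge G}} :=
  [set K | `[< exists2 x, is_vertex polytope x & K = gr [set x]%classic >]]%SET.

End Polytope.

(* Main.v *)
(** The sum over [V1] minus the sum over [V3] of [b] is the sum over the edges
    [e] of [x e] times the number of ends of [e] in [V1] minus the number in
    [V3]; this gives (vii) for the support of any point [x].  If [x e > 0], then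
    a point of minimal support among those supported in [gr x] and positive at
    [e] is a vertex: otherwise one could move in the direction of another point
    supported there, or in the opposite one, until a coordinate other than [e]
    vanishes.  From (viii), a point positive at [e] is built by lowering [b] at
    both ends of [e] until a cover containing both becomes tight, and then by
    deleting edges one by one, in the same way, from the remaining graph. *)

Require Import Defs.
From HB Require Import structures.
From mathcomp Require Import all_boot all_order all_algebra.
From mathcomp Require Import ring lra.
From mathcomp Require Import boolp classical_sets reals.

Set Implicit Arguments.
Unset Strict Implicit.
Unset Printing Implicit Defensive.

Import Order.TTheory GRing.Theory Num.Theory.
Local Open Scope ring_scope.

(** * Incidence and double counting *)

Section Incidence.
Context (R : realType) (G : multigraph).
Implicit Types (H : {set edge G}) (C U W : {set vertex G}).
Implicit Types (b : {ffun vertex G -> R}) (x : {ffun edge G -> R}).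

Lemma edges_betweenP H U W e :
  reflect (e \in H /\ exists u w, [/\ u \in U, w \in W & ends e = [set u; w]%SET])
          (e \in edges_between H U W).
Proof.
rewrite inE; apply: (iffP andP) => -[eH].
  by move=> /exists_inP[u uU /exists_inP[w wW /eqP ee]]; split=> //; exists u, w.
move=> [u [w [uU wW ee]]]; split=> //.
by apply/exists_inP; exists u => //; apply/exists_inP; exists w => //; apply/eqP.
Qed.

Lemma edges_between_eq0P H U W :
  edges_between H U W = finset.set0 <->
  forall e u w, e \in H -> u \in U -> w \in W -> ends e <> [set u; w]%SET.
Proof.
split=> [HUW0 e u w eH uU wW ee|HUW].
  suff: e \in edges_between H U W by rewrite HUW0 inE.
  by apply/edges_betweenP; split=> //; exists u, w.
apply/setP => e; rewrite [RHS]inE; apply/negP => /edges_betweenP[eH].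
by move=> [u [w [uU wW]]]; apply: HUW.
Qed.

Lemma endsP (e : edge G) : exists u w, ends e = [set u; w]%SET.
Proof.
have := ends_card e; rewrite leq_eqVlt => /andP[].
case/orP => [/eqP e1|e2]; last first.
  move=> le2; have /cards2P[u [w [_ ->]]] : #|ends e| == 2%N.
    by rewrite eqn_leq le2.
  by exists u, w.
move=> _; have /cards1P[u ->] : #|ends e| == 1%N by rewrite -e1.
by exists u, u; rewrite finset.setUid.
Qed.

(** Double counting; a loop has a single end, in agreement with its single occurrence in
    [incident]. *)
Lemma sum_polytope b x (A : {set vertex G}) : polytope b x ->
  \sum_(v in A) b v = \sum_e x e * \sum_(v in ends e) (v \in A)%:R.
Proof.
move=> [_ xb]; under eq_bigr => v _ do rewrite -xb big_mkcond /=.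
rewrite exchange_big; apply: eq_bigr => e _.
rewrite mulr_sumr big_mkcond [RHS]big_mkcond; apply: eq_bigr => v _.
by rewrite inE; case: (v \in A); rewrite /= ?mulr1 ?mulr0 ?if_same.
Qed.

End Incidence.

(** * Supports, faces and vertices of the polytope *)

Section PolytopeGraphs.
Context (R : realType) (G : multigraph) (b : {ffun vertex G -> R}).
Implicit Types (H K : {set edge G}) (x y z d : {ffun edge G -> R}).
Implicit Types (X : set {ffun edge G -> R}).

Lemma grP X e : reflect (exists2 x, X x & 0 < x e) (e \in gr X).
Proof. by rewrite inE; exact: asboolP. Qed.

Lemma gr1P x e : (e \in gr [set x]%classic) = (0 < x e).
Proof. by apply/grP/idP => [[_ -> //]|]; exists x. Qed.

Lemma polytope_eq0 x e : polytope b x -> e \notin gr [set x]%classic -> x e = 0.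
Proof. by move=> [x0 _]; rewrite gr1P -leNgt => xe; apply/le_anti; rewrite xe x0. Qed.

(** Positive coordinates survive averaging: one point of [X] is chosen for each edge of [gr X], and
    the mean is taken. *)
Lemma gr_average X : (X `<=` polytope b)%classic -> gr X != finset.set0 ->
  exists2 x, polytope b x & gr X = gr [set x]%classic.
Proof.
move=> XP H0; set H := gr X in H0 *.
have N0 : 0 < #|H|%:R :> R by rewrite ltr0n card_gt0.
(* The zero function is a default outside [H] and never enters the average. *)
have /choice[y yP] : forall e, exists y, e \in H -> X y /\ 0 < y e.
  move=> e; case: (boolP (e \in H)) => [/grP[y Xy ye]|_]; first by exists y.
  by exists [ffun=> 0].
have y0 e f : e \in H -> 0 <= y e f by move=> /yP[/XP[]].
exists [ffun f => (\sum_(e in H) y e f) / #|H|%:R].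
  split=> [f|v].
    by rewrite ffunE divr_ge0 ?ler0n// sumr_ge0// => e /y0.
  under eq_bigr => f _ do rewrite ffunE.
  rewrite -mulr_suml exchange_big /= (eq_bigr (fun=> b v)); last first.
    by move=> e /yP[/XP[_ ->]].
  by rewrite sumr_const -[b v *+ _]mulr_natr mulfK// gt_eqF.
apply/setP => f; rewrite gr1P ffunE pmulr_lgt0 ?invr_gt0//.
apply/idP/idP => [fH|].
  rewrite (bigD1 f)//= ltr_wpDr//; last by have [] := yP f fH.
  by apply: sumr_ge0 => e /andP[/y0].
move/lt0r_neq0/eqP => s0.
have [e eH ye] : exists2 e, e \in H & 0 < y e f.
  apply: contra_notP s0 => nex; apply: big1 => e eH; apply/le_anti.
  rewrite y0// andbT leNgt; apply/negP => ye; apply: nex; by exists e.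
by apply/grP; exists (y e) => //; have [] := yP e eH.
Qed.

(** Minus the sum of the coordinates outside [H] is at most 0 on the polytope, and vanishes exactly
    at the points supported in [H]. *)
Lemma support_face H :
  is_face (polytope b)
    [set x | polytope b x /\ gr [set x]%classic \subset H]%classic.
Proof.
exists [ffun e => - (e \notin H)%:R], 0.
have E x : \sum_e [ffun e => - (e \notin H)%:R] e * x e =
           - \sum_(e | e \notin H) x e.
  rewrite [X in _ = - X]big_mkcond -sumrN; apply: eq_bigr => e _.
  by rewrite ffunE; case: (e \notin H); rewrite ?mulN1r// mulNr mul0r.
split=> [x [x0 _]|]; first by rewrite E oppr_le0 sumr_ge0.
apply/seteqP; split=> x /= [Px xH]; split=> //.
  rewrite E big1 ?oppr0// => e eH; apply: polytope_eq0 => //.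
  apply: contra eH => ex. exact: (fintype.subsetP xH).
apply/fintype.subsetP => e; rewrite gr1P; apply: contraLR => eH.
move: xH; rewrite E => /eqP; rewrite oppr_eq0 psumr_eq0; last by case: Px.
by move=> /allP/(_ e (mem_index_enum _))/implyP/(_ eH)/eqP ->; rewrite ltxx.
Qed.

(* Move from [x] along a direction that does not decrease coordinate [e] until
   the first other coordinate vanishes. *)
Lemma shrink_support x z e : polytope b x -> polytope b z -> z <> x ->
    gr [set z]%classic \subset gr [set x]%classic -> 0 < x e ->
  exists2 y, polytope b y &
    gr [set y]%classic \proper gr [set x]%classic /\ 0 < y e.
Proof.
move=> Px Pz zx zsubx xe.
(* [d] is [z - x] up to sign; the sign makes [d e] nonnegative. *)
have [d [d0 dsum dsupp de]] : exists d, [/\ d <> 0,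
    forall v, \sum_(f in incident v) d f = 0,
    forall f, f \notin gr [set x]%classic -> d f = 0 & 0 <= d e].
  have [s s0 se] : exists2 s : R, s != 0 & 0 <= s * (z e - x e).
    have [ze|/ltW ze] := leP 0 (z e - x e).
      by exists 1; rewrite ?oner_eq0 ?mul1r.
    by exists (-1); rewrite ?oppr_eq0 ?oner_eq0// mulN1r oppr_ge0.
  exists [ffun f => s * (z f - x f)]; split=> [/ffunP d0|v|f fx|].
  - apply: zx; apply/ffunP => f; have /eqP := d0 f.
    by rewrite !ffunE mulf_eq0 (negPf s0) subr_eq0 => /eqP.
  - under eq_bigr do rewrite ffunE.
    by rewrite -mulr_sumr sumrB Px.2 Pz.2 subrr mulr0.
  - have fz : f \notin gr [set z]%classic.
      by apply: contra fx; apply: (fintype.subsetP zsubx).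
    by rewrite ffunE !polytope_eq0// subrr mulr0.
  - by rewrite ffunE.
(* Otherwise [d] is nonnegative with zero sum at each vertex, hence zero, as every edge has an
   end. *)
have [g dg] : exists g, d g < 0.
  have [h dh] : exists h, d h != 0.
    apply: contra_notP d0 => nex; apply/ffunP => h; rewrite ffunE.
    by apply/eqP/negPn/negP => dh; apply: nex; exists h.
  apply: contrapT => nex.
  have dge0 f : 0 <= d f by rewrite leNgt; apply/negP => df; apply: nex; exists f.
  have /andP[/card_gt0P[v vh] _] := ends_card h.
  have := dsum v => /eqP; rewrite psumr_eq0// => /allP/(_ h (mem_index_enum _)).
  by rewrite inE vh /= (negPf dh).
(* Ratio test: the least quotient over the decreasing coordinates is the longest step that keeps all
   coordinates nonnegative. *)
case: (@arg_minP _ _ _ g (fun f => d f < 0) (fun f => x f / - d f) dg) => f df fmin.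
set t := x f / - d f in fmin.
have t0 : 0 <= t by rewrite divr_ge0 ?Px.1// oppr_ge0 ltW.
exists [ffun h => x h + t * d h].
  split=> [h|v].
    rewrite ffunE; have [dh|dh] := leP 0 (d h).
      by rewrite addr_ge0 ?Px.1// mulr_ge0.
    by have := fmin h dh; rewrite ler_pdivlMr ?oppr_gt0// mulrN lerNl -subr_ge0 opprK addrC.
  under eq_bigr => h _ do rewrite ffunE.
  by rewrite big_split /= -mulr_sumr dsum mulr0 addr0 Px.2.
split; last by rewrite ffunE ltr_wpDr// mulr_ge0.
apply/properP; split.
  apply/fintype.subsetP => h; rewrite gr1P ffunE; apply: contraLR => hx.
  by rewrite dsupp// (polytope_eq0 Px hx) mulr0 addr0 ltxx.
exists f.
  by apply: contraLR df => /dsupp ->; rewrite ltxx.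
by rewrite gr1P ffunE /t invrN mulrN mulNr divfK ?subrr ?ltxx// lt_eqF.
Qed.

(** Induction on the size of the support; once [x] is the only point supported there, [support_face]
    makes it a vertex. *)
Lemma vertex_in_support x e : polytope b x -> 0 < x e ->
  exists2 y, is_vertex (polytope b) y &
    gr [set y]%classic \subset gr [set x]%classic /\ 0 < y e.
Proof.
have [n] := ubnP #|gr [set x]%classic|; elim: n x => // n IHn x + Px xe.
rewrite ltnS => lex.
have [[z [Pz zx zsub]]|nex] := pselect (exists z,
    [/\ polytope b z, z <> x & gr [set z]%classic \subset gr [set x]%classic]).
  have [y Py [yx ye]] := shrink_support Px Pz zx zsub xe.
  have [|v Vv [vy ve]] := IHn y _ Py ye.
    by rewrite (leq_trans _ lex)// proper_card.
  by exists v => //; split=> //; apply: (fintype.subset_trans vy); apply: proper_sub.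
exists x; last by split.
rewrite /is_vertex; have -> : [set x]%classic =
    [set y | polytope b y /\ gr [set y]%classic \subset gr [set x]%classic]%classic.
  apply/seteqP; split=> [y -> //|y [Py yx]].
  by apply: contrapT => nyx; apply: nex; exists y.
exact: support_face.
Qed.

Lemma vertex_polytope x : is_vertex (polytope b) x -> polytope b x.
Proof.
by move=> [c [d [_ xF]]]; have : [set x]%classic x by []; rewrite xF => -[].
Qed.

End PolytopeGraphs.

(** * Vertex covers, uncrossing and the construction of points *)

Section Slack.
Context (R : realType) (G : multigraph).
Implicit Types (H : {set edge G}) (C D U : {set vertex G}).
Implicit Types (b : {ffun vertex G -> R}).

(** A single signed sum, so that identities can be checked vertex by vertex. *)
Definition slack b C : R := \sum_v (if v \in C then b v else - b v).

Lemma slackE b C : slack b C = \sum_(v in C) b v - \sum_(v in ~: C) b v.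
Proof.
rewrite /slack (bigID (mem C)) /= -sumrN; congr (_ + _).
  by apply: eq_bigr => v ->.
by apply: eq_big => v; rewrite ?inE// => /negPf ->.
Qed.

Lemma slackC b C : slack b (~: C) = - slack b C.
Proof. by rewrite !slackE finset.setCK opprB. Qed.

Lemma slackU1 b C v : v \notin C -> slack b (v |: C) = slack b C + b v *+ 2.
Proof.
move=> vC; rewrite /slack (bigD1 v)//= [in RHS](bigD1 v)//= !inE eqxx (negPf vC).
rewrite (eq_bigr (fun u => if u \in C then b u else - b u)); last first.
  by move=> u /negPf uv; rewrite !inE uv.
by rewrite /= mulr2n; ring.
Qed.

(** Only the inequality of (viii) is kept, since lowering [b] along an edge creates tight covers. *)
Definition cover_cond H b := forall C, vertex_cover H C -> 0 <= slack b C.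

(** Bipartiteness recorded by one colour class [U], the other being its complement. *)
Definition separates U H := forall e, e \in H ->
  exists u w, [/\ u \in U, w \notin U & ends e = [set u; w]%SET].

Lemma bipartite_separates H : bipartite H -> exists U, separates U H.
Proof.
move=> [U [W [UW _ HUW]]]; exists U => e; rewrite -HUW => /edges_betweenP.
move=> [_ [u [w [uU wW ee]]]]; exists u, w; split=> //.
by rewrite (disjointFl UW).
Qed.

Lemma separatesC U H : separates U H -> separates (~: U) H.
Proof.
move=> UH e /UH[u [w [uU wU ee]]]; exists w, u.
by rewrite !inE negbK finset.setUC.
Qed.

Lemma separates_cover U H : separates U H -> vertex_cover H U.
Proof. by move=> UH e /UH[u [w [uU _ ->]]]; exists u; rewrite // !inE eqxx. Qed.

Lemma vertex_cover2 H C e u w :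
  vertex_cover H C -> e \in H -> ends e = [set u; w]%SET -> (u \in C) || (w \in C).
Proof.
move=> HC eH ee; have [v vC] := HC e eH.
by rewrite ee !inE => /orP[] /eqP <-; rewrite vC ?orbT.
Qed.

Lemma slack_separates U H b : separates U H -> cover_cond H b -> slack b U = 0.
Proof.
move=> UH Hb; apply/le_anti; rewrite (Hb _ (separates_cover UH)) andbT.
by rewrite -oppr_ge0 -slackC Hb//; apply: separates_cover; apply: separatesC.
Qed.

(** Intersection on [U] and union off [U]: the uncrossing operation for vertex covers of a bipartite
    graph. *)
Definition mix U C D :=
  [set v | if v \in U then (v \in C) && (v \in D) else (v \in C) || (v \in D)]%SET.

Lemma slack_mix U b C D :
  slack b (mix U C D) + slack b (mix (~: U) C D) = slack b C + slack b D.
Proof.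
rewrite /slack -!big_split; apply: eq_bigr => v _; rewrite !inE.
by case: (v \in U); case: (v \in C); case: (v \in D); rewrite //= addrC.
Qed.

(** [D] may miss [e], but the end of [e] outside [U] lies in [C], hence in the mix, which is the
    union there. *)
Lemma vertex_cover_mix U H C D e : separates U H -> vertex_cover H C ->
  vertex_cover (H :\ e) D -> ends e \subset C -> vertex_cover H (mix U C D).
Proof.
move=> UH HC HD eC f fH; have [u [w [uU wU fe]]] := UH f fH.
suff : (u \in mix U C D) || (w \in mix U C D).
  by case/orP => m; [exists u|exists w] => //; rewrite fe !inE eqxx ?orbT.
rewrite !inE uU (negPf wU); have [fe'|nfe] := eqVneq f e.
  have /fintype.subsetP/(_ w) := eC; rewrite -fe' fe !inE eqxx orbT => /(_ isT) ->.
  by rewrite /= orbT.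
have fD : f \in H :\ e by rewrite !inE nfe.
move: (vertex_cover2 HC fH fe) (vertex_cover2 HD fD fe).
by do 4!case: (_ \in _).
Qed.

Definition lower b (t : R) (e : edge G) : {ffun vertex G -> R} :=
  [ffun v => b v - t *+ (v \in ends e)].

Lemma slack_lower b t e C u w : ends e = [set u; w]%SET -> u != w ->
  slack (lower b t e) C =
  slack b C - t * ((-1) ^+ (u \notin C) + (-1) ^+ (w \notin C)).
Proof.
move=> ee uw; rewrite /slack.
have wu : w != u by rewrite eq_sym.
rewrite (bigD1 u)//= (bigD1 w wu)/= [in RHS](bigD1 u)//= [in RHS](bigD1 w wu)/=.
rewrite !ffunE ee !inE !eqxx orbT /=.
rewrite (eq_bigr (fun v => if v \in C then b v else - b v)); last first.
  move=> v /andP[/negPf vu /negPf vw].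
  by rewrite ffunE ee !inE vu vw subr0.
by case: (u \in C); case: (w \in C); rewrite /= ?expr0 ?expr1; ring.
Qed.

(* Lowering [b] along [e] affects only the covers containing both ends of [e],
   so it can go on until one of these becomes tight; uncrossing with the tight
   cover then makes [e] superfluous. *)
Lemma lower_edge U H b e : separates U H -> cover_cond H b -> e \in H ->
  exists t C, [/\ cover_cond H (lower b t e), cover_cond (H :\ e) (lower b t e),
    vertex_cover H C, ends e \subset C & t *+ 2 = slack b C].
Proof.
move=> UH Hb eH; have [u [w [uU wU ee]]] := UH e eH.
have uw : u != w by apply: contraNneq wU => <-.
pose P C := `[< vertex_cover H C >] && (ends e \subset C).
have PT : P [set: vertex G]%SET.
  rewrite /P finset.subsetT andbT; apply/asboolP => f fH.
  by have /andP[/card_gt0P[v vf] _] := ends_card f; exists v; rewrite // inE.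
case: (@arg_minP _ _ _ _ P (slack b) PT) => C /andP[/asboolP HC eC] Cmin.
(* Half the least slack, since lowering by [t] costs [t] at each end of [e]. *)
pose t := slack b C / 2; exists t, C.
have t2 : t *+ 2 = slack b C by rewrite -[t *+ 2]mulr_natr divfK// pnatr_eq0.
have uC : u \in C by apply: (fintype.subsetP eC); rewrite ee !inE eqxx.
have wC : w \in C by apply: (fintype.subsetP eC); rewrite ee !inE eqxx orbT.
have Ht : cover_cond H (lower b t e).
  move=> D HD; rewrite (slack_lower _ _ _ ee uw).
  have := vertex_cover2 HD eH ee; have := Hb D HD; have := Cmin D.
  rewrite /P ee finset.subUset !finset.sub1set (asboolT HD) /= -t2.
  (* Both ends in [D]: minimality of [C]. One end: the slack is unchanged. No end: [D] is not a
     cover. *)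
  case: (u \in D); case: (w \in D) => //=; rewrite ?expr0 ?expr1.
  - by move=> /(_ isT); lra.
  - by lra.
  - by lra.
split=> // D HD.
(* As [C] is now tight, the slack of [D] is the sum of the slacks of two mixes, both of which cover
   [H]. *)
have := slack_mix U (lower b t e) C D.
have C0 : slack (lower b t e) C = 0.
  by rewrite (slack_lower _ _ _ ee uw) uC wC /= expr0 -t2; ring.
rewrite C0 add0r => <-; apply: addr_ge0; apply: Ht.
  exact: vertex_cover_mix HC HD eC.
exact: (vertex_cover_mix (separatesC UH) HC HD eC).
Qed.

Lemma polytope_raise b t e x : 0 <= t -> polytope (lower b t e) x ->
  polytope b [ffun f => x f + t *+ (f == e)].
Proof.
move=> t0 [x0 xb]; split=> [f|v].
  by rewrite ffunE addr_ge0// mulrn_wge0.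
under eq_bigr do rewrite ffunE.
rewrite big_split /= xb ffunE -[RHS]addr0 -addrA; congr (_ + _).
have [ve|ve] := boolP (v \in ends e).
  rewrite (bigD1 e) ?inE//= eqxx big1 => [|f /andP[_ /negPf ->]//].
  by rewrite !addr0 addrC subrr.
rewrite oppr0 add0r big1// => f; rewrite inE => vf.
by case: eqVneq vf => // ->; rewrite (negPf ve).
Qed.

(** Induction on the number of edges: lower [b] along an edge, delete it, and put the amount [t]
    back on it afterwards. *)
Lemma cover_cond_polytope U H b : separates U H -> cover_cond H b ->
  exists2 x, polytope b x & gr [set x]%classic \subset H.
Proof.
have [n] := ubnP #|H|; elim: n H b => // n IHn H b; rewrite ltnS => leH UH Hb.
have [H0|[e eH]] := set_0Vmem H; last first.
  have [t [C [_ Het HC _ t2]]] := lower_edge UH Hb eH.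
  have t0 : 0 <= t by have := Hb C HC; rewrite -t2 pmulrn_lge0.
  have [||x Px xH] := IHn (H :\ e) (lower b t e) _ _ Het.
  - by rewrite (leq_trans _ leH)// [X in (_ < X)%N](cardsD1 e) eH.
  - by move=> f /setD1P[_ /UH].
  exists [ffun f => x f + t *+ (f == e)]; first exact: polytope_raise.
  apply/fintype.subsetP => f; rewrite gr1P ffunE; case: eqVneq => [-> //|fe].
  by rewrite addr0 -gr1P => /(fintype.subsetP xH); rewrite !inE => /andP[].
(* Without edges every set is a cover, as is its complement, so all slacks vanish and [slackU1]
   gives [b v = 0]. *)
have cov C : 0 <= slack b C by apply: Hb => e; rewrite H0 inE.
have slack0 C : slack b C = 0.
  by apply/le_anti; rewrite cov andbT -oppr_ge0 -slackC cov.
exists [ffun=> 0]; last by apply/fintype.subsetP => e; rewrite gr1P ffunE ltxx.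
split=> [e|v]; first by rewrite ffunE.
rewrite big1 => [|e _]; last by rewrite ffunE.
have := slackU1 b (negbT (finset.in_set0 v)); rewrite !slack0 add0r => /esym/eqP.
by rewrite mulrn_eq0 => /eqP.
Qed.

(** Strictness makes the amount [t] put on [e] positive; the remaining point is found in [H] with
    [e] kept. *)
Lemma strict_cover_polytope U H b e : separates U H -> cover_cond H b ->
    (forall C, vertex_cover H C -> ends e \subset C -> slack b C != 0) ->
    e \in H ->
  exists2 x, polytope b x & gr [set x]%classic \subset H /\ 0 < x e.
Proof.
move=> UH Hb Hstrict eH.
have [t [C [Ht _ HC eC t2]]] := lower_edge UH Hb eH.
have t0 : 0 < t by rewrite -(pmulrn_lgt0 _ (ltn0Sn 1)) t2 lt0r Hstrict// Hb.
have [x Px xH] := cover_cond_polytope UH Ht.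
exists [ffun f => x f + t *+ (f == e)]; first exact: polytope_raise (ltW t0) Px.
split; last by rewrite ffunE eqxx ltr_wpDl//; case: Px.
apply/fintype.subsetP => f; rewrite gr1P ffunE; case: eqVneq => [-> //|fe].
by rewrite addr0 -gr1P => /(fintype.subsetP xH).
Qed.

(** * Inequalities for covers and partitions *)

Lemma slack_ge0 b C :
  (0 <= slack b C) = (\sum_(v in ~: C) b v <= \sum_(v in C) b v).
Proof. by rewrite slackE subr_ge0. Qed.

Lemma slack_eq0 b C :
  slack b C = 0 <-> \sum_(v in C) b v = \sum_(v in ~: C) b v.
Proof. by rewrite slackE; split=> [/subr0_eq|->]; rewrite ?subrr. Qed.

(** Edges of [H] at [V3] must go to [V1] and have weight [m e = 0]; so [m] is nonnegative on [H],
    and positive exactly on the edges from [V1] to [V1] or [V2]. *)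
Lemma sum_partition b x (V1 V2 V3 : {set vertex G}) (H := gr [set x]%classic) :
    polytope b x -> [disjoint V1 & V2] -> [disjoint V1 & V3] ->
    [disjoint V2 & V3] -> [set: vertex G]%SET = V1 :|: V2 :|: V3 ->
    edges_between H (V2 :|: V3) V3 = finset.set0 ->
  \sum_(v in V3) b v <= \sum_(v in V1) b v /\
  (\sum_(v in V1) b v = \sum_(v in V3) b v <->
   edges_between H V1 (V1 :|: V2) = finset.set0).
Proof.
move=> Px d12 d13 d23 V123 /edges_between_eq0P H23.
pose s v : R := (v \in V1)%:R - (v \in V3)%:R.
pose m e : R := \sum_(v in ends e) s v.
have -> : \sum_(v in V1) b v = \sum_(v in V3) b v + \sum_e x e * m e.
  rewrite !(sum_polytope _ Px) -big_split; apply: eq_bigr => e _.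
  rewrite /= -mulrDr -big_split; congr (_ * _); apply: eq_bigr => v _ /=.
  by rewrite subrKC.
have [x0 _] := Px.
(* The factor [u != w] counts the end of a loop once. *)
have mE e u w : ends e = [set u; w]%SET -> m e = s u + s w *+ (u != w).
  rewrite /m => ->; have [->|uw] := eqVneq u w.
    by rewrite finset.setUid big_set1 addr0.
  by rewrite big_setU1 ?inE//= big_set1.
have V123v v : (v \in V1) || (v \in V2) || (v \in V3).
  by move/setP: V123 => /(_ v); rewrite !inE => <-.
have side v : [\/ [/\ v \in V1, (v \in V2) = false, (v \in V3) = false & s v = 1],
                  [/\ (v \in V1) = false, v \in V2, (v \in V3) = false & s v = 0]
                | [/\ (v \in V1) = false, (v \in V2) = false, v \in V3 & s v = -1]].
  rewrite /s; case/orP: (V123v v) => [/orP[]|] vi; rewrite vi.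
  - by constructor 1; rewrite (disjointFr d12 vi) (disjointFr d13 vi) subr0.
  - by constructor 2; rewrite (disjointFl d12 vi) (disjointFr d23 vi) subr0.
  - by constructor 3; rewrite (disjointFl d13 vi) (disjointFl d23 vi) sub0r.
have mP e : e \in H -> 0 <= m e /\
    (m e = 0 <-> forall u w, u \in V1 -> w \in V1 :|: V2 ->
                   ends e <> [set u; w]%SET).
  have m12 u w : u \in V1 -> w \in V1 :|: V2 -> ends e = [set u; w]%SET -> m e != 0.
    move=> u1 + /mE ->; rewrite inE.
    have -> : s u = 1 by case: (side u) => -[u1']; rewrite ?u1// in u1' *.
    have [[-> _ _ ->]|[_ -> _ ->]|[-> -> //]] := side w => _.
      by case: (u == w); rewrite ?addr0 ?oner_neq0// -mulr2n pnatr_eq0.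
    by rewrite mul0rn addr0 oner_neq0.
  move=> eH; have [u [w ee]] := endsP e.
  have ee' : ends e = [set w; u]%SET by rewrite finset.setUC.
  have huw := H23 e u w eH; have hwu := H23 e w u eH.
  suff [m0|[mpos [u' [w' [u1 w12 uw]]]]] : m e = 0 \/ 0 < m e /\
      exists u w, [/\ u \in V1, w \in V1 :|: V2 & ends e = [set u; w]%SET].
  - rewrite m0; split=> //; split=> // _ u' w' u1 w12 /(m12 _ _ u1 w12).
    by rewrite m0 eqxx.
  - split; first exact: ltW.
    by split=> [m0|h]; [move: mpos; rewrite m0 ltxx|case: (h u' w')].
  have ex12 u' w' : ends e = [set u'; w']%SET -> u' \in V1 ->
      w' \in V1 :|: V2 -> 0 <= m e -> m e = 0 \/ 0 < m e /\
      exists u w, [/\ u \in V1, w \in V1 :|: V2 & ends e = [set u; w]%SET].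
    move=> ee1 u1 w12 m0; right; rewrite lt0r m0 (m12 _ _ u1 w12 ee1).
    by split=> //; exists u', w'.
  have {}huw : u \in V2 :|: V3 -> w \in V3 -> False by move=> u23 /(huw u23).
  have {}hwu : w \in V2 :|: V3 -> u \in V3 -> False by move=> w23 /(hwu w23).
  move: huw hwu (ex12 _ _ ee) (ex12 _ _ ee'); rewrite (mE _ _ _ ee) !inE.
  have [<-|_] := eqVneq u w.
    rewrite addr0; case: (side u) => -[-> -> -> ->] /=.
    + by move=> _ _ + _; apply.
    + by left.
    + by case.
  (* [V1]-[V3] and [V2]-[V2] have weight 0, [V2]-[V3] and [V3]-[V3] are excluded, [V1]-[V1] and
     [V1]-[V2] have positive weight. *)
  case: (side u) (side w) => -[-> -> -> ->] [] [-> -> -> ->] /=;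
    rewrite ?addr0 ?add0r ?subrr ?addNr.
  + by move=> _ _ + _; apply=> //; apply: addr_ge0.
  + by move=> _ _ + _; apply.
  + by left.
  + by move=> _ _ _; apply.
  + by left.
  + by case.
  + by left.
  + by move=> _ [].
  + by case.
have xm0 e : 0 <= x e * m e.
  have [/mP[m0 _]|/(polytope_eq0 Px) ->] := boolP (e \in H); last by rewrite mul0r.
  exact: mulr_ge0.
split; first by rewrite lerDl sumr_ge0.
rewrite edges_between_eq0P; split=> [/eqP|H12].
  (* Nonnegative terms with sum zero all vanish, and [x e] is positive on [H]. *)
  rewrite -subr_eq0 addrAC subrr add0r psumr_eq0// => /allP sum0.
  move=> e u w eH; apply: (mP e eH).2.1.
  have := sum0 e (mem_index_enum _); rewrite mulf_eq0 => /orP[|/eqP//].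
  by move: eH; rewrite gr1P => /lt0r_neq0/negPf ->.
rewrite [X in _ + X]big1 ?addr0// => e _.
have [eH|/(polytope_eq0 Px) ->] := boolP (e \in H); last by rewrite mul0r.
by rewrite ((mP e eH).2.2 (fun u w => H12 e u w eH)) mulr0.
Qed.
End Slack.

(** * The cycle of implications *)

Theorem theorem35 (R : realType) (G : multigraph)
    (b : {ffun vertex G -> R}) (H : {set edge G})
    (V_nonempty : (0 < #|vertex G|)%N)
    (b_neq0 : b != 0) (b_ge0 : forall v, 0 <= b v)
    (H_bipartite : bipartite H) :
  [<-> graphs b H;
       exists2 X, (X `<=` polytope b)%classic & H = gr X;
       (exists2 x, polytope b x & H = gr [set x]%classic)
         \/ H = finset.set0;
       exists2 F, is_face (polytope b) F & H = gr F;
       exists2 Ks : {set {set edge G}},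
         Ks \subset vertex_graphs b & H = (\bigcup_(K in Ks) K)%SET;
       H = (\bigcup_(K in vertex_graphs b | K \subset H) K)%SET;
       H = finset.set0 \/
         forall V1 V2 V3 : {set vertex G},
           [disjoint V1 & V2] -> [disjoint V1 & V3] -> [disjoint V2 & V3] ->
           [set: vertex G]%SET = V1 :|: V2 :|: V3 ->
           edges_between H (V2 :|: V3) V3 = finset.set0 ->
           \sum_(v in V1) b v >= \sum_(v in V3) b v /\
           (\sum_(v in V1) b v = \sum_(v in V3) b v <->
            edges_between H V1 (V1 :|: V2) = finset.set0);
       H = finset.set0 \/
         forall C : {set vertex G}, vertex_cover H C ->
           \sum_(v in C) b v >= \sum_(v in ~: C) b v /\
           (\sum_(v in C) b v = \sum_(v in ~: C) b v <->
            vertex_cover H (~: C))].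
Proof.
have [U UH] := bipartite_separates H_bipartite.
tfae.
- by move=> [X XP <-]; exists X.
- move=> [X XP ->]; have [->|H0] := eqVneq (gr X) finset.set0; first by right.
  by left; have [x Px xX] := gr_average XP H0; exists x.
- move=> [[x Px ->]|->].
    exists [set y | polytope b y /\
                    gr [set y]%classic \subset gr [set x]%classic]%classic.
      exact: support_face.
    apply/setP => e; apply/idP/grP => [|[y [_ /fintype.subsetP yx] ye]].
      by rewrite gr1P => xe; exists x.
    by apply: yx; rewrite gr1P.
  (* The empty face, cut out by the equation 0 = 1. *)
  exists set0.
    exists [ffun=> 0], 1.
    have E (x : {ffun edge G -> R}) : \sum_e [ffun=> 0] e * x e = 0 :> R.
      by apply: big1 => e _; rewrite ffunE mul0r.
    split=> [x _|]; first by rewrite E ler01.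
    apply/seteqP; split=> x //= [_]; rewrite E => /esym/eqP.
    by rewrite oner_eq0.
  by apply/setP => e; rewrite [LHS]inE; apply/esym/negP => /grP[].
- move=> [F [c [d [cd FE]]] HF].
  (* All vertex graphs inside [H]; each edge of [H] lies in one of them by [vertex_in_support]. *)
  exists [set K in vertex_graphs b | K \subset H]%SET.
    by apply/fintype.subsetP => K; rewrite inE => /andP[].
  apply/setP => e; apply/idP/bigcupP => [|[K]]; last first.
    by rewrite inE => /andP[_ /fintype.subsetP]; apply.
  rewrite [in X in X -> _]HF => /grP[x Fx xe].
  have Px : polytope b x by move: Fx; rewrite FE => -[].
  have [y Vy [yx ye]] := vertex_in_support Px xe.
  exists (gr [set y]%classic); last by rewrite gr1P.
  rewrite inE; apply/andP; split; first by rewrite inE; apply/asboolP; exists y.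
  apply: (fintype.subset_trans yx); apply/fintype.subsetP => f.
  by rewrite gr1P HF => xf; apply/grP; exists x.
- move=> [Ks /fintype.subsetP KsV HK]; apply/eqP; rewrite finset.eqEsubset.
  apply/andP; split; last by apply/bigcupsP => K /andP[].
  rewrite {1}HK; apply/bigcupsP => K KKs; apply: (finset.bigcup_sup K).
  by rewrite KsV//= HK; apply: finset.bigcup_sup KKs.
- move=> HV; have [->|H0] := eqVneq H finset.set0; [by left|right].
  (* By (vi), [H] is the graph of the points supported in it; averaging reduces to one point. *)
  pose X := [set x | polytope b x /\ gr [set x]%classic \subset H]%classic.
  have HX : H = gr X.
    apply/setP => e; apply/idP/grP => [|[x [_ /fintype.subsetP xH] xe]].
      rewrite {1}HV => /bigcupP[K /andP[]]; rewrite inE.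
      move=> /asboolP[x /vertex_polytope Px ->] xH; rewrite gr1P => xe.
      by exists x.
    by apply: xH; rewrite gr1P.
  have XP : (X `<=` polytope b)%classic by move=> x [].
  move: H0; rewrite HX => /(gr_average XP)[x Px ->] V1 V2 V3.
  exact: sum_partition.
- move=> [->|HV]; [by left|right] => C HC.
  (* With [V2] empty, the condition on [V3] says that no edge avoids [C]. *)
  have [|||||le eq] := HV C finset.set0 (~: C).
  - by rewrite -finset.setI_eq0 finset.setI0.
  - by rewrite -finset.setI_eq0 finset.setICr.
  - by rewrite -finset.setI_eq0 finset.set0I.
  - by rewrite finset.setU0 finset.setUCr.
  - apply/edges_between_eq0P => e u w eH; rewrite !inE /= => uC wC ee.
    by have := vertex_cover2 HC eH ee; rewrite (negPf uC) (negPf wC).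
  split=> //; rewrite eq finset.setU0 edges_between_eq0P; split=> [HCC e eH|HC' e u w].
    have [u [w ee]] := endsP e; have := HCC e u w eH.
    have [uC|uC _] := boolP (u \in C); last first.
      by exists u; rewrite ?ee !inE// eqxx.
    have [wC|wC _] := boolP (w \in C); first by move=> /(_ isT isT).
    by exists w; rewrite ?ee !inE// eqxx orbT.
  move=> eH uC wC ee; have := vertex_cover2 HC' eH ee.
  by rewrite !inE uC wC.
- move=> [->|HV].
    exists set0; first by move=> x.
    by apply/setP => e; rewrite [RHS]inE; apply/negP => /grP[].
  have Hb : cover_cond H b by move=> C /HV[]; rewrite slack_ge0.
  exists [set x | polytope b x /\ gr [set x]%classic \subset H]%classic.
    by move=> x [].
  apply/setP => e; apply/grP/idP => [[x [_ /fintype.subsetP xH] xe]|eH].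
    by apply: xH; rewrite gr1P.
  have [C HC eC|x Px [xH xe]] := strict_cover_polytope UH Hb _ eH.
    (* Equality would make the complement of [C] a cover, yet all ends of [e] lie in [C]. *)
    apply/eqP => /slack_eq0 /(HV C HC).2 /(_ e eH)[v vC ve].
    by move: vC; rewrite finset.inE (fintype.subsetP eC).
  by exists x.
Qed.
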